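(* In the setting of the context, let $u\in\mathcal B_R$ and suppose that there is a set $U(u)\subset\mathcal B_R$ (the leaf set of $u$) such that $\{\|v-u\|_1: v\in U(u)\}=[0,d_{\max}(u)]$ for some $d_{\max}(u)>0$, and a finite constant $C_U^{(1)}(u)$ such that for every $v\in U(u)$, $$\sup_{k\in\mathbb N}\ \sum_{i=0}^k\|v(t_i)-u(t_i)\|_1\le C_U^{(1)}(u)\,\|v-u\|_1 .$$ Suppose that the observation matrix is $H$, the observation noise is uniformly distributed in $[-\epsilon,\epsilon]^{d_o}$, and the prior $q$ satisfies $q(v)>0$ for every $v\in U(u)$. Then for $0<\epsilon\le d_{\max}(u)\cdot C_U^{(1)}(u)\cdot\|H\|_1$ and every $k\in\mathbb N$, $$\mathbb E\big(\mathrm{diam}_1\,\mathrm{supp}\,\mu^{\mathrm{sm}}(\cdot\,|Y_0,\ldots,Y_k)\,\big|\,u\big)\ge\frac1e\cdot\frac{\epsilon}{C_U^{(1)}(u)\cdot\|H\|_1},$$ where $\mathrm{diam}_1\,\mathrm{supp}$ denotes the diameter of the support with respect to the $L_1$ norm.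
   Context: Dynamics: $\frac{du}{dt}=-Au-B(u,u)+f$ on $\mathbb R^d$, with $A$ a linear operator, $B:\mathbb R^d\times\mathbb R^d\to\mathbb R^d$ bilinear, $f\in\mathbb R^d$. For $v\in\mathbb R^d$, $v(t)=\Psi_t(v)$ is the solution with $v(0)=v$. Trapping ball assumption: there are $R,\delta>0$ with $\langle -Av-B(v,v)+f,v\rangle\le0$ whenever $\|v\|\in[R,R+\delta]$. $\mathcal B_R=\{v:\|v\|\le R\}$; for $v\in\mathcal B_R$ the solution exists for all $t\ge0$ and stays in $\mathcal B_R$. Observations: $t_i=ih$ with fixed $h>0$, $Y_i=Hu(t_i)+Z_i$, $H\in\mathbb R^{d_o\times d}$, $Z_i$ i.i.d. with density $\eta$. The prior $q$ is a probability density on $\mathbb R^d$ vanishing outside $\mathcal B_R$. The smoothing density is $\mu^{\mathrm{sm}}(v|Y_0,\ldots,Y_k)\propto q(v)\prod_{i=0}^k\eta(Y_i-H\Psi_{t_i}(v))$ for $v\in\mathcal B_R$, and $0$ otherwise; its support is the set of points where it is nonzero. For uniform noise on $[-\epsilon,\epsilon]^{d_o}$ this is the set of $v\in\mathcal B_R$ with $q(v)>0$ and $\|Y_i-Hv(t_i)\|_\infty\le\epsilon$, $0\le i\le k$. $\mathbb E(\cdot|u)$ is expectation over the noise with true initial point $u$. $\|v\|_1=\sum_i|v_i|$ and $\|H\|_1$ is the operator norm induced by $\|\cdot\|_1$. *)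

(* Defs.v *)
From HB Require Import structures.
From mathcomp Require Import all_boot all_order all_algebra finmap.
From mathcomp Require Import all_classical all_reals all_analysis.

Set Implicit Arguments.
Unset Strict Implicit.
Unset Printing Implicit Defensive.

Import Order.TTheory GRing.Theory Num.Theory.
Import numFieldNormedType.Exports.

Local Open Scope classical_set_scope.
Local Open Scope ring_scope.

Section vector_norms.
Context {R : realType}.

Definition dot n (v w : 'cV[R]_n) : R := \sum_(i < n) v i 0 * w i 0.

Definition norm2 n (v : 'cV[R]_n) : R := Num.sqrt (dot v v).

Definition norm1 n (v : 'cV[R]_n) : R := \sum_(i < n) `|v i 0|.

Definition opnorm1 m n (M : 'M[R]_(m, n)) : R :=
  sup [set norm1 (M *m v) | v in [set v : 'cV[R]_n | norm1 v <= 1]].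

Definition cball2 n (r : R) : set 'cV[R]_n := [set v | norm2 v <= r].

(* As [sup] is real-valued, the diameter of an unbounded set is 0 here; every
   set to which it is applied lies in a ball. The empty set has diameter 0. *)
Definition diam1 n (S : set 'cV[R]_n) : R :=
  sup [set norm1 (p.1 - p.2) | p in S `*` S].

End vector_norms.

(* MathComp-Analysis has no sigma-algebra on R^n seen as column vectors and no
   n-dimensional Lebesgue measure. The sigma-algebra is the one generated by
   the coordinates, as the library does for tuples. *)
Section measurable_cV.
Context {R : realType} (n : nat).

Let coor (i : 'I_n) (v : 'cV[R]_n) : measurableTypeR R := v i 0.

Let cV_set0 : g_sigma_preimage coor set0.
Proof. exact: sigma_algebra0. Qed.

Let cV_setC A : g_sigma_preimage coor A -> g_sigma_preimage coor (~` A).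
Proof. exact: sigma_algebraC. Qed.

Let cV_bigcup (F : _^nat) : (forall i, g_sigma_preimage coor (F i)) ->
  g_sigma_preimage coor (\bigcup_i (F i)).
Proof. exact: sigma_algebra_bigcup. Qed.

HB.instance Definition _ :=
  @isMeasurable.Build (measure_tuple_display (R.-ocitv.-measurable.-sigma))
  'cV[R]_n (g_sigma_preimage coor) cV_set0 cV_setC cV_bigcup.

End measurable_cV.

Lemma measurable_coord {R : realType} n (i : 'I_n) :
  measurable_fun [set: 'cV[R]_n] (fun v => v i 0 : measurableTypeR R).
Proof.
move=> _ Y mY; rewrite setTI; apply: sub_sigma_algebra => /=.
rewrite -bigcup_seq/=; exists i => /=; first by rewrite mem_index_enum.
by exists Y => //; rewrite setTI.
Qed.

Lemma measurable_fun_coordP {R : realType} d (T : measurableType d) n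
    (f : T -> 'cV[R]_n) :
  (forall i, measurable_fun setT (fun t => f t i 0 : measurableTypeR R)) ->
  measurable_fun setT f.
Proof.
move=> mf; suff mpre : g_sigma_preimage
    (fun i (t : T) => f t i 0 : measurableTypeR R) `<=` measurable.
  move=> _ A mA; apply: mpre.
  by rewrite (@g_sigma_preimage_comp _ _ _ _
    (fun i (v : 'cV[R]_n) => v i 0 : measurableTypeR R)); exists A.
apply: smallest_sub; first exact: sigma_algebra_measurable.
case: n => [|n] in f mf *; first by rewrite big_ord0.
rewrite -bigcup_mkord_ord; apply: bigcup_sub => i Ii.
by move=> A [B mB <-]; exact: mf.
Qed.

(* The vector with first coordinate p.1 followed by the coordinates of p.2. *)
Definition vcons {R : realType} n (p : measurableTypeR R * 'cV[R]_n) :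
  'cV[R]_n.+1 :=
  \col_(i < n.+1) if unlift ord0 i is Some j then p.2 j 0 else p.1.

Lemma measurable_vcons {R : realType} n : measurable_fun setT (@vcons R n).
Proof.
apply: measurable_fun_coordP => i.
have -> : (fun p => vcons p i 0) = (fun p : measurableTypeR R * 'cV[R]_n =>
    if unlift ord0 i is Some j then p.2 j 0 else p.1).
  by apply/funext => p; rewrite mxE.
case: unliftP => [j _|_]; last exact: measurable_fst.
by apply: (measurableT_comp (measurable_coord j)); exact: measurable_snd.
Qed.

Section lebesgue_cons.
Context {R : realType} (n : nat)
  (mu : {sigma_finite_measure set 'cV[R]_n -> \bar R}).

Definition lebesgue_cons : set 'cV[R]_n.+1 -> \bar R :=
  pushforward ((@lebesgue_measure R) \x mu)%E (@vcons R n).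

Let lebesgue_cons0 : lebesgue_cons set0 = 0%E.
Proof. by rewrite /lebesgue_cons /pushforward preimage_set0 measure0. Qed.

Let lebesgue_cons_ge0 A : (0 <= lebesgue_cons A)%E.
Proof. by rewrite /lebesgue_cons /pushforward; exact: measure_ge0. Qed.

Let lebesgue_cons_sigma_additive : semi_sigma_additive lebesgue_cons.
Proof.
move=> F mF tF mUF; rewrite /lebesgue_cons /pushforward preimage_bigcup.
apply: measure_semi_sigma_additive.
- by move=> i; rewrite -[X in measurable X]setTI; exact: measurable_vcons.
- move/trivIsetP : tF => tF; apply/trivIsetP => /= i j _ _ ij.
  by rewrite -preimage_setI (tF i j)// preimage_set0.
- by rewrite -preimage_bigcup -[X in measurable X]setTI; exact: measurable_vcons.
Qed.

HB.instance Definition _ := isMeasure.Build _ _ _ lebesgue_cons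
  lebesgue_cons0 lebesgue_cons_ge0 lebesgue_cons_sigma_additive.

Let lebesgue_cons_sigma_finite : sigma_finite setT lebesgue_cons.
Proof.
pose split (v : 'cV[R]_n.+1) : measurableTypeR R * 'cV[R]_n :=
  (v ord0 0, \col_j v (lift ord0 j) 0).
have vconsK : cancel (@vcons R n) split.
  move=> [x v]; rewrite /split /vcons mxE unlift_none; congr pair.
  by apply/colP => j; rewrite !mxE liftK.
have msplit : measurable_fun setT split.
  apply/measurable_fun_pairP; split; first exact: measurable_coord.
  apply: measurable_fun_coordP => j.
  rewrite (_ : (fun t => _) = (fun v : 'cV[R]_n.+1 => v (lift ord0 j) 0)).
    exact: measurable_coord.
  by apply/funext => v; rewrite /= mxE.
have /sigma_finiteP[F [FT ndF Foo]] := sigma_finiteT (@lebesgue_measure R).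
have /sigma_finiteP[G [GT ndG Goo]] := sigma_finiteT mu.
exists (fun k => split @^-1` (F k `*` G k)).
  rewrite -preimage_bigcup (_ : \bigcup_k _ = setT) ?preimage_setT//.
  rewrite -subTset => -[x y] _.
  have [i _ Fx] : (\bigcup_i F i) x by rewrite -FT.
  have [j _ Gy] : (\bigcup_j G j) y by rewrite -GT.
  exists (maxn i j) => //; split.
  - by move: x Fx; exact/subsetPset/ndF/leq_maxl.
  - by move: y Gy; exact/subsetPset/ndG/leq_maxr.
move=> k; have [mF Fk] := Foo k; have [mG Gk] := Goo k.
split; first by rewrite -[X in measurable X]setTI; apply: msplit => //;
  exact: measurableX.
rewrite /lebesgue_cons /pushforward -comp_preimage.
have -> : split \o @vcons R n = id by exact/funext.
by rewrite preimage_id product_measure1E// lte_mul_pinfty// ge0_fin_numE.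
Qed.

HB.instance Definition _ := @Measure_isSigmaFinite.Build _ _ _ lebesgue_cons
  lebesgue_cons_sigma_finite.

End lebesgue_cons.

(* n-dimensional Lebesgue measure, as an n-fold product measure. *)
Fixpoint lebesgue_cV {R : realType} n :
    {sigma_finite_measure set 'cV[R]_n -> \bar R} :=
  match n return {sigma_finite_measure set 'cV[R]_n -> \bar R} with
  | 0%N => @dirac _ 'cV[R]_0 0 R
  | n'.+1 => lebesgue_cons (@lebesgue_cV R n')
  end.

Lemma measurable_box {R : realType} n (a b : 'cV[R]_n) :
  measurable [set v : 'cV[R]_n | forall i, a i 0 <= v i 0 <= b i 0].
Proof.
rewrite (_ : mkset _ = \big[setI/setT]_(i < n)
    ((fun v : 'cV[R]_n => v i 0 : measurableTypeR R) @^-1`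
      `[a i 0, b i 0]%classic)).
  apply: bigsetI_measurable => i _.
  by rewrite -[X in measurable X]setTI; exact: measurable_coord.
rewrite -bigcap_seq; apply/seteqP; split => [v abv i _|v abv i]/=.
  by rewrite in_itv/=.
by have := abv i; rewrite /= in_itv/=; apply; exact: mem_index_enum.
Qed.

Lemma lebesgue_cV_box {R : realType} n (a b : 'cV[R]_n) :
  (forall i, a i 0 <= b i 0) ->
  lebesgue_cV n [set v : 'cV[R]_n | forall i, a i 0 <= v i 0 <= b i 0] =
  (\prod_(i < n) (b i 0 - a i 0))%:E.
Proof.
elim: n a b => [a b _|n IH a b ab].
  by rewrite /= diracE mem_set ?big_ord0// => -[].
pose tl (v : 'cV[R]_n.+1) : 'cV[R]_n := \col_j v (lift ord0 j) 0.
rewrite /= /lebesgue_cons /pushforward.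
rewrite (_ : _ @^-1` _ = `[a ord0 0, b ord0 0]%classic `*`
    [set v : 'cV[R]_n | forall i, tl a i 0 <= v i 0 <= tl b i 0]); last first.
  apply/seteqP; split => [[x v] /= abv|[x v] /= [abx abv] i].
    split; first by rewrite in_itv/=; have := abv ord0; rewrite mxE unlift_none.
    by move=> i; have := abv (lift ord0 i); rewrite !mxE liftK.
  rewrite mxE; case: unliftP => [j ->|->]; last by rewrite in_itv/= in abx.
  by have := abv j; rewrite !mxE.
rewrite product_measure1E//; last exact: measurable_box.
rewrite IH; last by move=> i; rewrite !mxE.
rewrite [X in (X * _)%E]lebesgue_measure_itv/= lte_fin.
rewrite big_ord_recl; under eq_bigr do rewrite !mxE.
have := ab ord0; rewrite le_eqVlt => /orP[/eqP ->|->].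
  by rewrite ltxx mul0e subrr mul0r.
by rewrite -EFinD -EFinM.
Qed.

Section dynamics.
Context {R : realType} (d : nat).
Variables (A : {linear 'cV[R]_d -> 'cV[R]_d})
  (B : {bilinear 'cV[R]_d -> 'cV[R]_d -> 'cV[R]_d}) (f : 'cV[R]_d).

Definition vector_field (v : 'cV[R]_d) : 'cV[R]_d := - A v - B v v + f.

(* At t = 0 the equation is imposed through continuity at 0. *)
Definition is_solution (v0 : 'cV[R]_d) (v : R -> 'cV[R]_d) : Prop :=
  [/\ v 0 = v0,
      {within `[0, +oo[, continuous v} &
      forall t : R, 0 < t -> is_derive t (1 : R) v (vector_field (v t))].

Definition trapping (r delta : R) : Prop :=
  forall v, r <= norm2 v <= r + delta -> dot (vector_field v) v <= 0.

(* Psi t v is constrained only for t >= 0 and v in the ball of radius r, where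
   the trapping property guarantees that global solutions exist. *)
Definition is_solution_map (r : R) (Psi : R -> 'cV[R]_d -> 'cV[R]_d) : Prop :=
  forall v, cball2 r v -> is_solution v (Psi ^~ v).

End dynamics.

Section densities.
Context {R : realType}.

Definition is_prob_density n (p : 'cV[R]_n -> R) : Prop :=
  [/\ measurable_fun setT p, (forall v, 0 <= p v) &
      (\int[lebesgue_cV n]_v (p v)%:E = 1)%E].

Definition uniform_cube_pdf n (eps : R) (z : 'cV[R]_n) : R :=
  if [forall i, `|z i 0| <= eps] then ((2 * eps) ^+ n)^-1 else 0.

Context d (T : measurableType d) (P : probability T R).

Definition has_pdf n (X : {RV P >-> 'cV[R]_n}) (p : 'cV[R]_n -> R) : Prop :=
  forall S, measurable S ->
    distribution P X S = (\int[lebesgue_cV n]_(x in S) (p x)%:E)%E.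

Definition mutually_independent n (Z : nat -> {RV P >-> 'cV[R]_n}) : Prop :=
  forall (J : {fset nat}) (S : nat -> set 'cV[R]_n),
    (forall j, measurable (S j)) ->
    P (\bigcap_(j in [set` J]) (Z j @^-1` S j)) =
    (\prod_(j <- J) P (Z j @^-1` S j))%E.

Definition iid_with_pdf n (Z : nat -> {RV P >-> 'cV[R]_n})
    (p : 'cV[R]_n -> R) : Prop :=
  mutually_independent Z /\ forall i, has_pdf (Z i) p.

End densities.

Section smoothing.
Context {R : realType} (d m : nat).
Variables (r h : R) (Psi : R -> 'cV[R]_d -> 'cV[R]_d) (H : 'M[R]_(m, d))
  (q : 'cV[R]_d -> R) (eta : 'cV[R]_m -> R).

Definition obs_time (i : nat) : R := i%:R * h.

Definition smoothing_weight k (y : 'I_k.+1 -> 'cV[R]_m) (v : 'cV[R]_d) : R :=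
  q v * \prod_(i < k.+1) eta (y i - H *m Psi (obs_time i) v).

(* mu y is the smoothing density given the observations y. It is determined up
   to a positive factor depending on y only, i.e. the normalising constant;
   leaving this factor free does not affect the support, and also covers the
   observations for which the weight integrates to 0. *)
Definition is_smoothing_density k
    (mu : ('I_k.+1 -> 'cV[R]_m) -> 'cV[R]_d -> R) : Prop :=
  forall y, exists2 c : R, 0 < c & forall v,
    mu y v = if v \in cball2 r then c * smoothing_weight y v else 0.

End smoothing.

(* The set of points where p is nonzero; no closure is taken. *)
Definition supp {R : realType} d (p : 'cV[R]_d -> R) : set 'cV[R]_d :=
  [set v | p v != 0].

(* Main.v *)
Require Import Defs.
From HB Require Import structures.
From mathcomp Require Import all_boot all_order all_algebra finmap.
From mathcomp Require Import all_classical all_reals all_analysis.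
From mathcomp Require Import ring lra.

Set Implicit Arguments.
Unset Strict Implicit.
Unset Printing Implicit Defensive.

Import Order.TTheory GRing.Theory Num.Theory.
Import numFieldNormedType.Exports.

Local Open Scope classical_set_scope.
Local Open Scope ring_scope.

(** Put s := eps / (C |H|_1). Since s <= dmax, the leaf set contains a point v
    at distance s from u, and it contains u itself. Both points lie in the
    support as soon as, for every i <= k, both Z_i and Z_i + c_i lie in the
    cube [-eps, eps]^m, where c_i := H (u(t_i) - v(t_i)). On that event the
    diameter is at least s, so the expected diameter is at least s times the
    probability of the event ([expectation_ge_on]).

    The uniform law gives the intersection of the cube with its translate by
    -c_i the probability \prod_j (1 - |c_ij| / (2 eps)), which is at least
    1 - |c_i|_1 / (2 eps) by the Weierstrass product inequality
    ([integral_cube_overlap_ge]). The union bound over i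
    ([probability_bigsetI_ge]) bounds the probability of the event from below
    by 1 - \sum_i |c_i|_1 / (2 eps), and the definition of the leaf set gives
    \sum_i |c_i|_1 <= |H|_1 C s = eps. The event thus has probability at least
    1/2, which is larger than 1/e. *)

(** The Weierstrass product inequality. The upper bound by 1 is what makes the
    induction go through. *)
Lemma prod_onem_ge (R : realFieldType) n (x : 'I_n -> R) :
  (forall i, 0 <= x i <= 1) ->
  1 - \sum_(i < n) x i <= \prod_(i < n) (1 - x i) <= 1.
Proof.
elim: n x => [|n IH] x x01; first by rewrite !big_ord0 subr0 lexx.
rewrite !big_ord_recr /=.
have /andP[lo hi] := IH (fun i => x (widen_ord (leqnSn n) i)) (fun=> x01 _).
by move: (x01 ord_max) lo hi => /andP[]; nra.
Qed.

(** * The L1 norm, its operator norm and its diameter *)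

Section norms.
Context {R : realType}.

Lemma norm1_ge0 n (v : 'cV[R]_n) : 0 <= norm1 v.
Proof. exact: sumr_ge0. Qed.

Lemma norm1_eq0 n (v : 'cV[R]_n) : norm1 v = 0 -> v = 0.
Proof.
move=> /psumr_eq0P v0; apply/colP => i; rewrite mxE.
by apply/eqP; rewrite -normr_eq0; apply/eqP; apply: v0.
Qed.

Lemma norm1Z n (a : R) (v : 'cV[R]_n) : norm1 (a *: v) = `|a| * norm1 v.
Proof.
by rewrite /norm1 mulr_sumr; apply: eq_bigr => i _; rewrite mxE normrM.
Qed.

Lemma norm1B n (v w : 'cV[R]_n) : norm1 (v - w) <= norm1 v + norm1 w.
Proof.
by rewrite /norm1 -big_split; apply: ler_sum => i _; rewrite !mxE ler_normB.
Qed.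

Lemma ler_coord_norm1 n (v : 'cV[R]_n) i : `|v i 0| <= norm1 v.
Proof. by rewrite /norm1 (bigD1 i)//= lerDl sumr_ge0. Qed.

Lemma norm1_le_norm2 n (v : 'cV[R]_n) : norm1 v <= n%:R * norm2 v.
Proof.
have vi i : `|v i 0| <= norm2 v.
  rewrite -sqrtr_sqr ler_wsqrtr// /dot (bigD1 i)//= -expr2 lerDl.
  by apply: sumr_ge0 => j _; rewrite -expr2 sqr_ge0.
apply: le_trans (ler_sum _ (fun i _ => vi i)) _.
by rewrite sumr_const card_ord mulr_natl.
Qed.

Lemma opnorm1_has_ubound m n (M : 'M[R]_(m, n)) :
  has_ubound [set norm1 (M *m v) | v in [set v : 'cV[R]_n | norm1 v <= 1]].
Proof.
exists (\sum_(i < m) \sum_(j < n) `|M i j|) => _ [v /= v1 <-].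
apply: ler_sum => i _; rewrite mxE (le_trans (ler_norm_sum _ _ _))//.
apply: ler_sum => j _; rewrite normrM ler_piMr//.
exact: le_trans (ler_coord_norm1 _ _) v1.
Qed.

Lemma opnorm1_ge0 m n (M : 'M[R]_(m, n)) : 0 <= opnorm1 M.
Proof.
apply: le_trans (ub_le_sup (opnorm1_has_ubound M) _).
  exact: (norm1_ge0 (M *m 0)).
by exists 0 => //=; rewrite -[0](scale0r 0) norm1Z normr0 mul0r ler01.
Qed.

Lemma norm1_mulmx m n (M : 'M[R]_(m, n)) v :
  norm1 (M *m v) <= opnorm1 M * norm1 v.
Proof.
have [/norm1_eq0 ->|v0] := eqVneq (norm1 v) 0.
  by rewrite mulmx0 -[X in norm1 X](scale0r 0) norm1Z normr0 mul0r
     mulr_ge0 ?opnorm1_ge0 ?norm1_ge0.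
have v_gt0 : 0 < norm1 v by rewrite lt_neqAle eq_sym v0 norm1_ge0.
rewrite -ler_pdivrMr// mulrC -[X in X * _]gtr0_norm ?invr_gt0// -norm1Z.
rewrite scalemxAr; apply: ub_le_sup; first exact: opnorm1_has_ubound.
exists ((norm1 v)^-1 *: v) => //=.
by rewrite norm1Z gtr0_norm ?invr_gt0// mulVf.
Qed.

Lemma diam1_ge0 n (S : set 'cV[R]_n) : 0 <= diam1 S.
Proof.
rewrite /diam1; set D := (X in sup X).
have [[[x [p Sp px]] Dub]|D0] := pselect (has_sup D); last first.
  by rewrite sup_out.
apply: le_trans (ub_le_sup Dub (ex_intro2 _ _ p Sp px)).
by rewrite -px norm1_ge0.
Qed.

(** The ball matters because [sup] only bounds the elements of a bounded set. *)
Lemma diam1_ge n (r : R) (S : set 'cV[R]_n) v w :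
  S `<=` cball2 r -> S v -> S w -> norm1 (v - w) <= diam1 S.
Proof.
move=> Sr Sv Sw; apply: ub_le_sup; last by exists (v, w).
exists (n%:R * r + n%:R * r) => _ [[x y] [/= /Sr xr /Sr yr] <-].
apply: le_trans (norm1B _ _) _; apply: lerD.
  by apply: le_trans (norm1_le_norm2 _) _; rewrite ler_wpM2l.
by apply: le_trans (norm1_le_norm2 _) _; rewrite ler_wpM2l.
Qed.

End norms.

(** * Two bounds for probabilities and expectations *)

Section probability_bounds.
Context d (T : measurableType d) (R : realType) (P : probability T R).

(** The diameter of a random support is not known to be measurable, hence a
    bound straight from the definition of the integral: it is a supremum over
    the simple functions below [X], and [c] times the indicator of [A] is one of
    them. *)
Lemma expectation_ge_on (A : set T) (X : T -> R) (c : R) :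
  measurable A -> 0 <= c -> (forall w, 0 <= X w) ->
  (forall w, A w -> c <= X w) -> (c%:E * P A <= 'E_P[X])%E.
Proof.
move=> mA c0 X0 cX; rewrite unlock ge0_integralTE; last first.
  by move=> w; rewrite lee_fin.
apply: ereal_sup_ubound.
exists (scale_nnsfun (indic_nnsfun R mA) c0).
  move=> w; rewrite lee_fin -[X in X <= _]/(c * \1_A w) indicE.
  by case: (boolP (w \in A)); rewrite ?mulr1 ?mulr0// inE => /cX.
by rewrite sintegralrM sintegral_indic.
Qed.

(** The union bound, applied to the complements of the events. *)
Lemma probability_bigsetI_ge n (E : nat -> set T) (x : nat -> R) :
  (forall i, measurable (E i)) ->
  (forall i, (i < n)%N -> ((1 - x i)%:E <= P (E i))%E) ->
  ((1 - \sum_(i < n) x i)%:E <= P (\big[setI/setT]_(i < n) E i))%E.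
Proof.
move=> mE xE.
rewrite -[X in P X]setCK setC_bigsetI probability_setC; last first.
  by apply: bigsetU_measurable => i _; exact: measurableC.
rewrite EFinB leeB//.
apply: le_trans (@Boole_inequality _ _ _ P (fun i => ~` E i) n _) _.
  by move=> i _; exact: measurableC.
rewrite -sumEFin; apply: lee_sum => i _.
have := xE i (ltn_ord i).
rewrite [X in _ -> (X <= _)%E](probability_setC P (mE i)) EFinB.
by rewrite !leeBlDr ?fin_num_measure // addeC.
Qed.

End probability_bounds.

(** * The uniform law on a cube and the translates of the cube *)

Section uniform_cube.
Context {R : realType} (n : nat) (eps : R).

Lemma uniform_cube_pdf_neq0 (z : 'cV[R]_n) : 0 < eps ->
  (uniform_cube_pdf eps z != 0) = [forall i, `|z i 0| <= eps].
Proof.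
move=> eps_gt0; rewrite /uniform_cube_pdf; case: ifP; rewrite ?eqxx// => _.
by rewrite invr_neq0// expf_neq0// mulf_neq0// gt_eqF.
Qed.

(** Noise values that remain possible after a shift by [c]: the intersection of
    two translates of the cube, hence a box, of side lengths
    [2 * eps - `|c i 0|] when these are nonnegative. *)
Definition cube_overlap (c : 'cV[R]_n) : set 'cV[R]_n :=
  [set z | forall i, `|z i 0| <= eps /\ `|z i 0 + c i 0| <= eps].

Let lo (c : 'cV[R]_n) : 'cV[R]_n := \col_i Num.max (- eps) (- eps - c i 0).
Let hi (c : 'cV[R]_n) : 'cV[R]_n := \col_i Num.min eps (eps - c i 0).

Let cube_overlapE c :
  cube_overlap c = [set z | forall i, lo c i 0 <= z i 0 <= hi c i 0].
Proof.
apply/seteqP; split => z /= zc i; move: (zc i); rewrite !mxE ge_max le_min.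
  rewrite !ler_norml => -[/andP[? ?] /andP[? ?]].
  by apply/andP; split; apply/andP; split; lra.
move=> /andP[/andP[? ?] /andP[? ?]]; rewrite !ler_norml.
by split; apply/andP; split; lra.
Qed.

Lemma measurable_cube_overlap c : measurable (cube_overlap c).
Proof. by rewrite cube_overlapE; exact: measurable_box. Qed.

Lemma integral_cube_overlap (c : 'cV[R]_n) : 0 < eps ->
  (forall i, `|c i 0| <= 2 * eps) ->
  (\int[lebesgue_cV n]_(z in cube_overlap c) (uniform_cube_pdf eps z)%:E =
   (\prod_(i < n) (1 - `|c i 0| / (2 * eps)))%:E)%E.
Proof.
move=> eps_gt0 ceps.
have hilo i : hi c i 0 - lo c i 0 = 2 * eps - `|c i 0|.
  rewrite !mxE; case: (ger0P (c i 0)) => ci.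
    by rewrite max_l ?min_r; lra.
  by rewrite max_r ?min_l; lra.
rewrite (eq_integral (fun=> (((2 * eps) ^+ n)^-1)%:E)); last first.
  move=> z; rewrite inE /uniform_cube_pdf => zc; case: ifPn => // /forallP[] i.
  exact: (zc i).1.
rewrite integral_cst//; last exact: measurable_cube_overlap.
rewrite cube_overlapE [X in (_ * X)%E]lebesgue_cV_box; last first.
  by move=> i; rewrite -subr_ge0 hilo subr_ge0.
rewrite -EFinM -exprVn -[X in _ ^+ X]card_ord -prodr_const -big_split/=.
congr EFin; apply: eq_bigr => i _; rewrite hilo.
by field; rewrite gt_eqF.
Qed.

Lemma integral_cube_overlap_ge (c : 'cV[R]_n) : 0 < eps -> norm1 c <= 2 * eps ->
  ((1 - norm1 c / (2 * eps))%:E <=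
   \int[lebesgue_cV n]_(z in cube_overlap c) (uniform_cube_pdf eps z)%:E)%E.
Proof.
move=> eps_gt0 ceps.
have cieps i : `|c i 0| <= 2 * eps.
  exact: le_trans (ler_coord_norm1 _ _) ceps.
have eps2 : 0 < 2 * eps by rewrite mulr_gt0.
rewrite integral_cube_overlap// lee_fin /norm1 mulr_suml.
have c01 i : 0 <= `|c i 0| / (2 * eps) <= 1.
  by rewrite divr_ge0 ?(ltW eps2)//= ler_pdivrMr// mul1r.
by have /andP[] := prod_onem_ge c01.
Qed.

End uniform_cube.

(** * The smoothing density *)

(** The positive factor left free in [mu] does not move its zeros. *)
Lemma supp_smoothing_density (R : realType) d m (r h : R)
    (Psi : R -> 'cV[R]_d -> 'cV[R]_d) (H : 'M[R]_(m, d)) (q : 'cV[R]_d -> R)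
    (eta : 'cV[R]_m -> R) k (mu : ('I_k.+1 -> 'cV[R]_m) -> 'cV[R]_d -> R) :
  is_smoothing_density r h Psi H q eta mu ->
  forall y, supp (mu y) = [set v | [/\ cball2 r v, q v != 0 &
    forall i, eta (y i - H *m Psi (obs_time h i) v) != 0]].
Proof.
move=> + y => /(_ y)[c c0 muE]; apply/seteqP; split => v; rewrite /supp /= muE.
  case: ifPn; rewrite ?eqxx// inE => vr.
  rewrite /smoothing_weight !mulf_eq0 !negb_or => /and3P[_ qv /prodf_neq0 etav].
  by split => // i; exact: etav.
move=> [vr qv etav]; rewrite mem_set// /smoothing_weight !mulf_neq0//.
  by rewrite gt_eqF.
by apply/prodf_neq0 => i _; exact: etav.
Qed.

Theorem theorem3p1 (R : realType) (d m : nat)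
    (A : {linear 'cV[R]_d -> 'cV[R]_d})
    (B : {bilinear 'cV[R]_d -> 'cV[R]_d -> 'cV[R]_d})
    (f : 'cV[R]_d) (r delta : R) (r_gt0 : 0 < r) (delta_gt0 : 0 < delta)
    (trap : trapping A B f r delta)
    (Psi : R -> 'cV[R]_d -> 'cV[R]_d) (Psi_sol : is_solution_map A B f r Psi)
    (h : R) (h_gt0 : 0 < h) (H : 'M[R]_(m, d))
    (q : 'cV[R]_d -> R) (q_pdf : is_prob_density q)
    (q_ball : forall v, ~ cball2 r v -> q v = 0)
    (u : 'cV[R]_d) (u_ball : cball2 r u)
    (U : set 'cV[R]_d) (U_ball : U `<=` cball2 r)
    (dmax : R) (dmax_gt0 : 0 < dmax)
    (U_dist : [set norm1 (v - u) | v in U] = `[0, dmax]%classic)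
    (C : R)
    (U_leaf : forall v, U v ->
      (ereal_sup [set (\sum_(i < k.+1)
          norm1 (Psi (obs_time h i) v - Psi (obs_time h i) u))%:E
        | k in [set: nat]] <= (C * norm1 (v - u))%:E)%E)
    (q_pos : forall v, U v -> 0 < q v)
    (eps : R) (eps_gt0 : 0 < eps) (eps_le : eps <= dmax * C * opnorm1 H)
    (dT : measure_display) (T : measurableType dT) (P : probability T R)
    (Z : nat -> {RV P >-> 'cV[R]_m})
    (Z_iid : iid_with_pdf Z (uniform_cube_pdf eps))
    (k : nat) (mu : ('I_k.+1 -> 'cV[R]_m) -> 'cV[R]_d -> R)
    (mu_sm : is_smoothing_density r h Psi H q (uniform_cube_pdf eps) mu) :
  (((expR 1)^-1 * (eps / (C * opnorm1 H)))%:E <=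
   'E_P[fun w => diam1 (supp (mu (fun i : 'I_k.+1 =>
          (H *m Psi (obs_time h i) u + Z i w)%R)))])%E.
Proof.
set L := opnorm1 H in eps_le *.
have CL_gt0 : 0 < C * L.
  by rewrite -(pmulr_rgt0 _ dmax_gt0) mulrA; exact: lt_le_trans eps_le.
pose s := eps / (C * L).
have s_gt0 : 0 < s by rewrite divr_gt0.
(* [eps_le] says that [s <= dmax], so that the distance [s] is attained. *)
have [v Uv vs] : [set norm1 (v - u) | v in U] s.
  by rewrite U_dist /= in_itv/= (ltW s_gt0) ler_pdivrMr// mulrA.
(* The distance 0 is attained as well, and only by [u]. *)
have Uu : U u.
  have [w Uw /norm1_eq0/eqP] : [set norm1 (v - u) | v in U] 0.
    by rewrite U_dist /= in_itv/= lexx ltW.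
  by rewrite subr_eq0 => /eqP <-.
pose c i : 'cV[R]_m := H *m (Psi (obs_time h i) u - Psi (obs_time h i) v).
have sum_c : \sum_(i < k.+1) norm1 (c i) <= eps.
  have -> : eps = L * (C * s).
    by rewrite mulrA (mulrC L) /s mulrCA divff ?mulr1// gt_eqF.
  apply: (@le_trans _ _ (\sum_(i < k.+1)
      L * norm1 (Psi (obs_time h i) v - Psi (obs_time h i) u))).
    apply: ler_sum => i _; apply: le_trans (norm1_mulmx _ _) _.
    by rewrite -opprB -scaleN1r norm1Z normrN1 mul1r.
  rewrite -mulr_sumr ler_wpM2l ?opnorm1_ge0// -lee_fin -vs.
  by apply: le_trans (U_leaf _ Uv); apply: ereal_sup_ubound; exists k.
pose E i : set T := Z i @^-1` cube_overlap eps (c i).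
have mE i : measurable (E i).
  rewrite -[E i]setTI; apply: (measurable_funPT (Z i)) => //.
  exact: measurable_cube_overlap.
pose joint := \big[setI/setT]_(i < k.+1) E i.
have mjoint : measurable joint by exact: bigsetI_measurable.
have Pjoint : ((2^-1)%:E <= P joint)%E.
  apply: le_trans (@probability_bigsetI_ge _ _ _ P k.+1 E
    (fun i => norm1 (c i) / (2 * eps)) mE _).
    rewrite lee_fin -mulr_suml lerBrDr -lerBrDl.
    by rewrite ler_pdivrMr ?mulr_gt0//; lra.
  move=> i ik; rewrite -[P (E i)]/(distribution P (Z i) _) Z_iid.2; last first.
    exact: measurable_cube_overlap.
  apply: integral_cube_overlap_ge => //.
  have : norm1 (c i) <= \sum_(j < k.+1) norm1 (c j).
    rewrite (bigD1 (Ordinal ik))//= lerDl sumr_ge0// => j _.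
    exact: norm1_ge0.
  by lra.
set X := (X in 'E_P[X]%E).
have X_ge0 w : 0 <= X w by exact: diam1_ge0.
have sX w : joint w -> s <= X w.
  rewrite /joint -bigcap_mkord => Aw.
  rewrite -vs /X (supp_smoothing_density mu_sm).
  apply: (@diam1_ge _ _ r); first by move=> x [].
  - split; [exact: U_ball|by rewrite gt_eqF// q_pos|move=> i].
    rewrite uniform_cube_pdf_neq0//; apply/forallP => j.
    have [_] := Aw i (ltn_ord i) j; rewrite /c mulmxBr !mxE.
    by congr (`|_| <= _); ring.
  - split; [exact: U_ball|by rewrite gt_eqF// q_pos|move=> i].
    rewrite uniform_cube_pdf_neq0//; apply/forallP => j.
    have [] := Aw i (ltn_ord i) j; rewrite !mxE => + _.
    by congr (`|_| <= _); ring.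
apply: le_trans (expectation_ge_on P mjoint (ltW s_gt0) X_ge0 sX).
apply: (@le_trans _ _ (s%:E * (2^-1)%:E)%E); last first.
  by rewrite lee_wpmul2l// lee_fin ltW.
(* 1 / e <= 1 / 2, since e >= 1 + 1. *)
rewrite -EFinM lee_fin mulrC ler_pM2l// lef_pV2 ?posrE ?expR_gt0//.
by have := expR_ge1Dx (1 : R); lra.
Qed.
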